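(* Let $(U_k)_{k\ge1}$ be an increasing chain $U_1\subset U_2\subset\cdots$ of subsets of the positive rationals with $|U_k|=k$. If \[\lim_{k\to\infty}\lim_{N\to\infty}\frac{\log G'_{U_k}(N)}{\log N}=1,\] then \[\lim_{k\to\infty}\lim_{N\to\infty}\frac{\log F'_{k}(N)}{\log N}=1.\]
   Context: A $U$-pattern with basepoint $x$ and nonzero rational scaling factor $r$ is $x+r\cdot U=\{x+ru:u\in U\}$. $G'_{U_k}(N)$ is the size of the smallest set of integers that contains a $U_k$-pattern with basepoint $x$ for $N$ distinct integer values of $x$. $F'_k(N)$ is the size of the smallest set of integers containing a $k$-term arithmetic progression with common difference $d$ for $N$ distinct integer values of $d$. *)

(* Defs.v *)
From HB Require Import structures.
From mathcomp Require Import all_boot all_order all_algebra finmap.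
From mathcomp Require Import all_classical all_reals all_analysis.

Set Implicit Arguments.
Unset Strict Implicit.
Unset Printing Implicit Defensive.

Import Order.TTheory GRing.Theory Num.Theory.
Import numFieldNormedType.Exports.

Local Open Scope classical_set_scope.
Local Open Scope ring_scope.

(* The value is 0 when P is empty; [GprimeP] and [FprimeP] below show that this
   default is never used by G' and F'. *)
Definition least (P : set nat) : nat :=
  xget 0%N [set n | P n /\ forall m, P m -> (n <= m)%N].

Definition pattern (U : {fset rat}) (x r : rat) : {fset rat} :=
  [fset (x + r * u)%R | u in U]%fset.

Definition has_basepoints (U : {fset rat}) (N : nat) (S : {fset int}) : Prop :=
  exists2 X : {fset int}, #|` X|%fset = N &
    forall x : int, x \in X ->
      exists2 r : rat, r != 0 &
        fsubset (pattern U x%:~R r) [fset n%:~R | n in S]%fset.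

Definition Gprime (U : {fset rat}) (N : nat) : nat :=
  least [set #|` S|%fset | S in [set S | has_basepoints U N S]].

Definition progression (k : nat) (a d : int) : {fset int} :=
  [fset (a + d *+ i)%R | i in iota 0 k]%fset.

(* d = 0 is not excluded. Every nonempty set contains a constant progression, so
   excluding it would only replace F' k N by F' k (N + 1) for k, N >= 1. *)
Definition has_differences (k N : nat) (S : {fset int}) : Prop :=
  exists2 D : {fset int}, #|` D|%fset = N &
    forall d : int, d \in D ->
      exists a : int, fsubset (progression k a d) S.

Definition Fprime (k N : nat) : nat :=
  least [set #|` S|%fset | S in [set S | has_differences k N S]].

(* lim_(k -> oo) lim_(N -> oo) f k N = l, where k ranges over k >= 1 and the
   existence of every inner limit is part of the assertion. *)
Definition iterated_limit (R : realType) (f : nat -> nat -> R) (l : R) : Prop :=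
  exists2 g : nat -> R,
    (forall k, (1 <= k)%N -> f k N @[N --> \oo] --> g k) &
    g k @[k --> \oo] --> l.

Lemma leastP (P : set nat) : P !=set0 ->
  P (least P) /\ forall m, P m -> (least P <= m)%N.
Proof.
move=> [n0 Pn0]; have exP : exists n, `[< P n >] by exists n0; apply/asboolP.
apply: (@xgetPex _ 0%N [set n | P n /\ forall m, P m -> (n <= m)%N]).
case: (ex_minnP exP) => n /asboolP Pn nmin.
by exists n; split=> // m Pm; apply: nmin; apply/asboolP.
Qed.

Definition initial_ints (N : nat) : {fset int} := [fset n%:Z | n in iota 0 N]%fset.

Lemma card_initial_ints N : #|` initial_ints N|%fset = N.
Proof.
rewrite card_imfset /=; last by move=> m n [].
by rewrite undup_id ?iota_uniq// size_iota.
Qed.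

Lemma FprimeP (k N : nat) :
  (exists2 S, has_differences k N S & #|` S|%fset = Fprime k N) /\
  (forall S, has_differences k N S -> (Fprime k N <= #|` S|%fset)%N).
Proof.
have [] := @leastP [set #|` S|%fset | S in [set S | has_differences k N S]].
  pose S := [fset (d *+ i)%R | d in initial_ints N, i in iota 0 k]%fset.
  exists #|` S|%fset, S => //; exists (initial_ints N).
    exact: card_initial_ints.
  move=> d dN; exists 0; apply/fsubsetP => _ /imfsetP[i /= ik ->].
  by rewrite add0r; apply/imfset2P; exists d => //; exists i.
move=> [S SN eS] minS; split; first by exists S.
by move=> T TN; apply: minS; exists T.
Qed.

Lemma GprimeP (U : {fset rat}) (N : nat) :
  (exists2 S, has_basepoints U N S & #|` S|%fset = Gprime U N) /\
  (forall S, has_basepoints U N S -> (Gprime U N <= #|` S|%fset)%N).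
Proof.
have [] := @leastP [set #|` S|%fset | S in [set S | has_basepoints U N S]].
  pose r : rat := (\prod_(u <- enum_fset U) denq u)%:~R.
  have r0 : r != 0.
    by rewrite intr_eq0 prodf_seq_neq0; apply/allP => u _; rewrite implyTb denq_neq0.
  have rU u : u \in U -> r * u \is a Num.int.
    move=> uU; rewrite /r (big_rem u)//= intrM mulrAC -[X in _ * X * _]divq_num_den.
    by rewrite [_%:~R * (_ / _)]mulrC divfK ?intr_eq0 ?denq_neq0// -intrM intr_int.
  pose S := [fset Num.floor (x%:~R + r * u)%R | x in initial_ints N, u in U]%fset.
  exists #|` S|%fset, S => //; exists (initial_ints N).
    exact: card_initial_ints.
  move=> x xN; exists r => //; apply/fsubsetP => _ /imfsetP[u /= uU ->].
  apply/imfsetP; exists (Num.floor (x%:~R + r * u)) => /=.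
    by apply/imfset2P; exists x => //; exists u.
  by rewrite floorK ?rpredD ?intr_int ?rU.
move=> [S SN eS] minS; split; first by exists S.
by move=> T TN; apply: minS; exists T.
Qed.

(* Main.v *)
Require Import Defs.
From mathcomp Require Import all_boot all_order all_algebra finmap.
From mathcomp Require Import all_classical all_reals all_analysis.
From mathcomp Require Import ring lra zify.

(** Geometrically, a progression samples a line [y = a + d t] at [t = 0, ..., K - 1]
    and a pattern samples [y = x + r t] at [t \in U]. The projective map
    [(t, y) |-> (1 / t, y / t)] exchanges slope and intercept, so it turns
    progressions with [N] differences into patterns with [N] basepoints, at the
    cost of taking one dilate of the set per element of [U]. Hence
    [G'_U(N) <= |U| F'_K(N)] for some [K] depending on [U], which bounds the
    exponent of [F'_K] from below; [F'_K(N) <= K N] bounds it from above, and it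
    exists because [F'_K] is submultiplicative. *)

Local Open Scope ring_scope.

Import Order.TTheory GRing.Theory Num.Theory.
Import numFieldNormedType.Exports.

(** * Finite sets: cardinalities of images, subsets, bounds *)

Lemma leq_card_imfset2 (T1 T2 T : choiceType) (f : T1 -> T2 -> T)
    (A : {fset T1}) (B : {fset T2}) :
  (#|` [fset f x y | x in A, y in B]%fset| <= #|` A| * #|` B|)%N.
Proof.
rewrite -(size_allpairs f); apply: uniq_leq_size; first exact: fset_uniq.
by move=> _ /imfset2P[x /= xA [y /= yB ->]]; apply: allpairs_f.
Qed.

Lemma card_in_imfset2 (T1 T2 T : choiceType) (f : T1 -> T2 -> T)
    (A : {fset T1}) (B : {fset T2}) :
  {in A & B, forall x y, {in A & B, forall x' y',
    f x y = f x' y' -> x = x' /\ y = y'}} ->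
  #|` [fset f x y | x in A, y in B]%fset| = (#|` A| * #|` B|)%N.
Proof.
move=> f_inj; apply/eqP; rewrite eqn_leq leq_card_imfset2/=.
rewrite -(size_allpairs f); apply: uniq_leq_size.
  apply: allpairs_uniq; rewrite ?fset_uniq// => -[x y] [x' y'].
  move=> /allpairsP[[a b] /= [aA bB [-> ->]]].
  move=> /allpairsP[[a' b'] /= [a'A b'B [-> ->]]] e.
  by have [-> ->] := f_inj _ _ aA bB _ _ a'A b'B e.
by move=> _ /allpairsP[[x y] /= [xA yB ->]]; apply/imfset2P; exists x => //; exists y.
Qed.

Lemma fset_card_subset (T : choiceType) (A : {fset T}) n : (n <= #|` A|)%N ->
  exists2 B : {fset T}, fsubset B A & #|` B|%fset = n.
Proof.
move=> nA; exists [fset x | x in take n (enum_fset A)]%fset.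
  by apply/fsubsetP => _ /imfsetP[x /= /mem_take xA ->].
rewrite card_imfset//= undup_id; last exact: take_uniq.
by rewrite size_take_min; apply/minn_idPl.
Qed.

Lemma fset_int_bounded (A : {fset int}) :
  exists B : int, forall x, x \in A -> `|x| < B.
Proof.
exists (1 + \sum_(x <- enum_fset A) `|x|) => x xA.
rewrite (big_rem x)//= addrCA ltrDl ltr_wpDr// sumr_ge0//.
Qed.

(** * Monotonicity, growth and submultiplicativity of [Fprime] *)

Lemma mem_progression k a d i : (i < k)%N -> a + d *+ i \in progression k a d.
Proof. by move=> ik; apply/imfsetP; exists i => //=; rewrite mem_iota. Qed.

Lemma Fprime_gt0 k N : (0 < k)%N -> (0 < N)%N -> (0 < Fprime k N)%N.
Proof.
move=> k0 N0; have [[S [D DN SD] <-] _] := FprimeP k N.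
have /fset0Pn[d /SD[a /fsubsetP aS]] : D != fset0 by rewrite -cardfs_gt0 DN.
by rewrite cardfs_gt0; apply/fset0Pn; exists (a + d *+ 0); apply/aS/mem_progression.
Qed.

Lemma leq_Fprime_length k K N : (k <= K)%N -> (Fprime k N <= Fprime K N)%N.
Proof.
move=> kK; have [[S [D DN SD] <-] _] := FprimeP K N; have [_] := FprimeP k N.
apply; exists D => // d /SD[a /fsubsetP aS]; exists a.
apply/fsubsetP => _ /imfsetP[i /= + ->]; rewrite mem_iota => ik.
by apply/aS/mem_progression; apply: leq_trans kK.
Qed.

Lemma leq_Fprime k M N : (M <= N)%N -> (Fprime k M <= Fprime k N)%N.
Proof.
move=> MN; have [[S [D DN SD] <-] _] := FprimeP k N; have [_] := FprimeP k M.
have [|D' /fsubsetP D'D D'M] := @fset_card_subset _ D M; first by rewrite DN.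
by apply; exists D' => // d /D'D /SD.
Qed.

Lemma Fprime_leM k N : (Fprime k N <= N * k)%N.
Proof.
have [_ Fle] := FprimeP k N.
have := leq_card_imfset2 _ _ _ (fun d i : int => d * i) (initial_ints N) (initial_ints k).
rewrite !card_initial_ints; apply: leq_trans.
apply: Fle; exists (initial_ints N); first exact: card_initial_ints.
move=> d dN; exists 0; apply/fsubsetP => _ /imfsetP[i /= ik ->].
apply/imfset2P; exists d => //; exists i%:Z => /=.
  by apply/imfsetP; exists i.
by rewrite add0r -mulr_natr natz.
Qed.

(* The two witnesses are combined as digits in a base [T] so large that sums of
   differences stay distinct. *)
Lemma Fprime_submul k M N : (Fprime k (M * N) <= Fprime k M * Fprime k N)%N.
Proof.
have [[S [D DM SD] <-] _] := FprimeP k M; have [[S' [D' DN SD'] <-] _] := FprimeP k N.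
have [_ Fle] := FprimeP k (M * N).
have [B DB] := fset_int_bounded D; pose T := B + B.
apply: leq_trans (leq_card_imfset2 _ _ _ (fun x y : int => x + T * y) _ _).
apply: Fle; exists [fset (x + T * y)%R | x in D, y in D']%fset.
  rewrite card_in_imfset2 ?DM ?DN// => x y xD yD' x' y' x'D y'D' e.
  have := DB _ xD; have := DB _ x'D; rewrite !ltr_norml => /andP[? ?] /andP[? ?].
  suff eyy' : y = y' by split=> //; move: e; rewrite eyy' => /addIr.
  have : y - y' = 0; last by move/eqP; rewrite subr_eq0 => /eqP.
  (* [x - x'] is a multiple of [T = 2 B] of absolute value less than [2 B], hence zero. *)
  by rewrite /T in e; nia.
move=> _ /imfset2P[d /= /SD[a /fsubsetP aS] [d' /= /SD'[a' /fsubsetP aS'] ->]].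
exists (a + T * a'); apply/fsubsetP => _ /imfsetP[i /= + ->]; rewrite mem_iota => ik.
apply/imfset2P; exists (a + d *+ i); first exact/aS/mem_progression.
exists (a' + d' *+ i); first exact/aS'/mem_progression.
by rewrite mulrDr mulrnDl mulrnAr addrACA.
Qed.

(** * From progressions to patterns *)

Lemma common_numerator (U : {fset rat}) : (forall u, u \in U -> 0 < u) ->
  exists2 q : rat, q != 0 &
    exists i : rat -> nat, forall u, u \in U -> (0 < i u)%N /\ u * (i u)%:R = q.
Proof.
move=> U0; pose q : int := \prod_(u <- enum_fset U) numq u.
have q0 : 0 < q by rewrite /q big_seq; apply: prodr_gt0 => u uU; rewrite numq_gt0 U0.
exists q%:~R; first by rewrite intr_eq0 gt_eqF.
suff Ui u : exists i, u \in U -> (0 < i)%N /\ u * i%:R = q%:~R.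
  by exists (fun u => projT1 (cid (Ui u))) => u uU; case: cid => i /= /(_ uU).
have [uU|] := boolP (u \in U); last by exists 0%N.
(* As [q] is the product of all numerators, [q / u] is the denominator of [u] times the other
   numerators. *)
pose j : int := denq u * \prod_(v <- rem u (enum_fset U)) numq v.
have uj : u * j%:~R = q%:~R.
  rewrite /q (big_rem u)//= /j !intrM mulrA.
  by rewrite -[X in X * _ * _]divq_num_den divfK ?intr_eq0 ?denq_neq0.
have j0 : 0 < j.
  by rewrite -(ltr0z rat) -(pmulr_rgt0 _ (U0 _ uU)) uj ltr0z.
exists `|j|%N => _; split; first by rewrite absz_gt0 gt_eqF.
by rewrite -uj natr_absz gtr0_norm.
Qed.

(* Writing [q = u i], the term [a + d i] of a progression equals
   [i (d + (a / q) u)], so dividing it by [i] gives the term at [u] of a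
   pattern with basepoint [d]. *)
Lemma Gprime_le_Fprime (U : {fset rat}) : (forall u, u \in U -> 0 < u) ->
  exists K, forall N, (Gprime U N <= Fprime K N * #|` U|%fset)%N.
Proof.
move=> U0; have [q q0 [i Ui]] := common_numerator _ U0.
(* Progressions of this length have a term at every index [i u]. *)
exists (\sum_(u <- enum_fset U) i u).+1 => N; set K := _.+1.
have iK u : u \in U -> (i u < K)%N.
  by move=> uU; rewrite ltnS (big_rem u)//= leq_addr.
(* Scaling by a common multiple of the [i u] keeps all quotients by [i u] integral. *)
pose P := \prod_(u <- enum_fset U) i u.
have P0 : (0 < P)%N.
  by rewrite /P big_seq; apply: prodn_cond_gt0 => u /Ui[].
have iP u : u \in U -> (i u %| P)%N.
  by move=> uU; rewrite /P (big_rem u)//= dvdn_mulr.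
have [[S [D DN SD] <-] _] := FprimeP K N; have [_ Gle] := GprimeP U N.
(* Translating [S] by [B] makes its elements positive, so that the scaling factor [P (a + B) / q] is
   nonzero. *)
have [B SB] := fset_int_bounded S.
apply: leq_trans
  (leq_card_imfset2 _ _ _ (fun (s : int) u => (s + B) * (P %/ i u)%N%:Z) _ _).
apply: Gle; exists [fset (P%:Z * d)%R | d in D]%fset.
  rewrite card_imfset//=; apply: mulfI; by rewrite gt_eqF.
move=> _ /imfsetP[d /= /SD[a /fsubsetP aS] ->].
have aB : 0 < a + B.
  have /aS/SB : a + d *+ 0 \in progression K a d by exact: mem_progression.
  by rewrite mulr0n addr0 ltr_norml => /andP[]; lra.
have PQ0 : P%:R != 0 :> rat by rewrite pnatr_eq0 -lt0n.
exists (P%:R * (a + B)%:~R / q).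
  by rewrite !mulf_neq0 ?invr_eq0// intr_eq0 gt_eqF.
apply/fsubsetP => _ /imfsetP[u /= uU ->].
have [iu0 uiq] := Ui _ uU.
have i0 : (i u)%:R != 0 :> rat by rewrite pnatr_eq0 -lt0n.
apply/imfsetP; exists ((a + d *+ i u + B) * (P %/ i u)%N%:Z) => /=.
  apply/imfset2P; exists (a + d *+ i u); last by exists u.
  exact/aS/mem_progression/iK.
rewrite -[P in LHS](divnK (iP _ uU)); set Q := (P %/ _)%N.
rewrite -uiq !(intrM, intrD, PoszM, natrM, rmorphMn)/= -!pmulrn -mulr_natr.
have u0 : u != 0 by rewrite gt_eqF ?U0.
by field; apply/andP.
Qed.

Local Open Scope classical_set_scope.

(** * Growth exponents of sequences of natural numbers *)

Section Logarithms.
Variable R : realType.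

Lemma cvg_div_ln (C : R) : C / ln N%:R @[N --> \oo] --> (0 : R).
Proof.
rewrite -[X in _ --> X](mulr0 C); apply: cvgMl_tmp.
apply/gtr0_cvgV0; first by near=> N; rewrite ln_gt0// ltr1n; near: N; exact: nbhs_infty_gt.
apply/cvgryPge => A; near=> N.
have AN : expR A <= N%:R by near: N; exact: nbhs_infty_ger.
by rewrite -[A]expRK ler_ln ?posrE ?expR_gt0// (lt_le_trans (expR_gt0 A)).
Unshelve. all: by end_near. Qed.

(* Fekete's lemma in multiplicative form: the limit is the infimum. *)
Lemma submul_ln_cvg (f : nat -> nat) :
  (forall N, (0 < N)%N -> (0 < f N)%N) ->
  (forall M N, (M <= N)%N -> (f M <= f N)%N) ->
  (forall M N, (f (M * N) <= f M * f N)%N) ->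
  exists l : R, (ln (f N)%:R / ln N%:R : R) @[N --> \oo] --> l.
Proof.
move=> f0 fle fM; pose h N : R := ln (f N)%:R / ln N%:R.
have lnf0 N : (0 < N)%N -> 0 <= ln (f N)%:R :> R.
  by move=> N0; rewrite ln_ge0// ler1n f0.
(* Exponents start at 1 because [f 1] may exceed 1. *)
have fX M j : (0 < M)%N -> (f (M ^ j.+1) <= f M ^ j.+1)%N.
  move=> M0; elim: j => [|j IH]; first by rewrite !expn1.
  by rewrite expnS (leq_trans (fM _ _))// [leqRHS]expnS leq_mul2l IH orbT.
(* Take [M ^ j <= N < M ^ j.+1]: the [j] factors [f M] give [h M], and the extra one gives the error
   term. *)
have hle M N : (1 < M)%N -> (1 < N)%N -> h N <= h M + ln (f M)%:R / ln N%:R.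
  move=> M1 N1; have M0 := ltnW M1; have N0 := ltnW N1.
  have lM : 0 < ln M%:R :> R by rewrite ln_gt0// ltr1n.
  have lN : 0 < ln N%:R :> R by rewrite ln_gt0// ltr1n.
  have /andP[] := trunc_log_bounds M1 N0; set j := trunc_log M N => jN Nj.
  have fNj : ln (f N)%:R <= ln (f M)%:R *+ j.+1 :> R.
    rewrite -lnXn ?ltr0n ?f0// -natrX ler_ln ?posrE ?ltr0n ?expn_gt0 ?f0//.
    by rewrite ler_nat (leq_trans (fle _ _ (ltnW Nj)))// fX.
  have jlN : ln M%:R *+ j <= ln N%:R :> R.
    by rewrite -lnXn ?ltr0n// -natrX ler_ln ?posrE ?ltr0n ?expn_gt0 ?M0// ler_nat.
  rewrite /h ler_pdivrMr// mulrDl divfK ?gt_eqF// (le_trans fNj)// mulrSr lerD2r.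
  by rewrite mulrAC ler_pdivlMr// mulrnAl -mulrnAr ler_wpM2l ?lnf0.
(* At [N = 0] and [N = 1] the quotient has the default value 0, which could spoil the infimum. *)
pose E := [set h N | N in [set N | (1 < N)%N]].
have Elb : has_lbound E.
  exists 0 => _ [N /= N1 <-]; rewrite divr_ge0 ?lnf0 ?(ltnW N1)//.
  by rewrite ln_ge0// ler1n ltnW.
have E0 : E !=set0 by exists (h 2), 2%N.
exists (inf E); apply/cvgrPdist_le => e e0.
have e20 : 0 < e / 2 by rewrite divr_gt0.
have [_ [M /= M1 <-] hM] := inf_adherent e20 (conj E0 Elb).
have /cvgrPdist_le /(_ _ e20) cM := cvg_div_ln (ln (f M)%:R).
near=> N.
have N1 : (1 < N)%N by near: N; exact: nbhs_infty_gt.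
have infN : inf E <= h N by apply: ge_inf => //; exists N.
have hN := hle _ _ M1 N1.
have : `|0 - ln (f M)%:R / ln N%:R| <= e / 2 :> R by near: N.
rewrite sub0r normrN => /(le_trans (ler_norm _)) small.
by rewrite distrC ger0_norm ?subr_ge0// lerBlDr; move: hM; rewrite /h in hN *; lra.
Unshelve. all: by end_near. Qed.

Lemma ln_nat_le (m n : nat) : (0 < n)%N -> (m <= n)%N -> ln m%:R <= ln n%:R :> R.
Proof.
(* For [m = 0] the convention [ln 0 = 0] is used. *)
move=> n0; case: m => [_|m mn]; first by rewrite ln0// ln_ge0// ler1n.
by rewrite ler_ln ?posrE ?ltr0n// ler_nat.
Qed.

Lemma ln_natM_le (m n c : nat) : (0 < n)%N -> (0 < c)%N -> (m <= n * c)%N ->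
  ln m%:R <= ln n%:R + ln c%:R :> R.
Proof.
move=> n0 c0 mnc; rewrite -lnM ?posrE ?ltr0n// -natrM.
by apply: ln_nat_le => //; rewrite muln_gt0 n0.
Qed.

(** A constant factor [c] only adds [ln c / ln N], which tends to 0. *)
Lemma cvg_ln_ratio_le (f h : nat -> nat) (c : nat) (lf lh : R) : (0 < c)%N ->
  (forall N, (0 < N)%N -> (0 < h N)%N) ->
  (forall N, (f N <= h N * c)%N) ->
  (ln (f N)%:R / ln N%:R : R) @[N --> \oo] --> lf ->
  (ln (h N)%:R / ln N%:R : R) @[N --> \oo] --> lh -> lf <= lh.
Proof.
move=> c0 h0 fh flf hlh; rewrite -[lh]addr0.
apply: ler_cvg_to flf (cvgD hlh (cvg_div_ln (ln c%:R))) _; near=> N.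
have N1 : (1 < N)%N by near: N; exact: nbhs_infty_gt.
rewrite -mulrDl ler_wpM2r ?invr_ge0 ?ln_ge0 ?ler1n ?(ltnW N1)//.
by apply: ln_natM_le => //; apply/h0/ltnW.
Unshelve. all: by end_near. Qed.

Lemma cvg_ln_ratio_id : (ln N%:R / ln N%:R : R) @[N --> \oo] --> (1 : R).
Proof.
apply: cvg_near_cst; near=> N; rewrite divff// gt_eqF// ln_gt0// ltr1n.
by near: N; exact: nbhs_infty_gt.
Unshelve. all: by end_near. Qed.

End Logarithms.

Local Close Scope classical_set_scope.

(** * Squeezing the exponents of [Fprime] towards 1 *)

Theorem mainTheorem6 (R : realType) (U : nat -> {fset rat})
    (U_pos : forall k, (1 <= k)%N -> forall u, u \in U k -> 0 < u)
    (U_card : forall k, (1 <= k)%N -> #|` U k|%fset = k)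
    (U_chain : forall k, (1 <= k)%N -> fsubset (U k) (U k.+1)) :
  iterated_limit
    (fun k N => ln (Gprime (U k) N)%:R / ln N%:R : R) 1 ->
  iterated_limit
    (fun k N => ln (Fprime k N)%:R / ln N%:R : R) 1.
Proof.
move=> [g Gg g1].
have cvgF k : exists l : R, (1 <= k)%N ->
    ((ln (Fprime k N)%:R / ln N%:R : R) @[N --> \oo] --> l)%classic.
  have [k1|] := boolP (1 <= k)%N; last by exists 0.
  have [l Fl] := @submul_ln_cvg R _ (fun N => Fprime_gt0 k N k1)
    (@leq_Fprime k) (@Fprime_submul k).
  by exists l.
pose l k : R := projT1 (cid (cvgF k)).
have Fl k : (1 <= k)%N -> ((ln (Fprime k N)%:R / ln N%:R : R) @[N --> \oo] --> l k)%classic.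
  by move=> k1; rewrite /l; case: cid => x /= /(_ k1).
exists l => //.
have l_le1 k : (1 <= k)%N -> l k <= 1.
  move=> k1; apply: (cvg_ln_ratio_le R (Fprime k) id k) => //.
  - by move=> N; exact: Fprime_leM.
  - exact: Fl.
  - exact: cvg_ln_ratio_id.
apply/cvgrPdist_le => e e0.
have /cvgrPdist_le /(_ _ e0) [n _ ge] := g1.
(* One pattern set with exponent within [e] of 1 suffices; the index is [n.+1] since [U 0] is
   unconstrained. *)
have ge1 := ge n.+1 (leqnSn n).
have [K GK] := Gprime_le_Fprime _ (U_pos n.+1 isT).
near=> k.
have k1 : (1 <= k)%N by near: k; exact: nbhs_infty_ge.
have Kk : (K <= k)%N by near: k; exact: nbhs_infty_ge.
(* [Fprime] grows with the length, so the bound by [Fprime K] passes to all [k >= K]. *)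
have gl : g n.+1 <= l k.
  apply: (cvg_ln_ratio_le R (Gprime (U n.+1)) (Fprime k) n.+1) => //.
  - by move=> N; exact: Fprime_gt0.
  - move=> N; rewrite -{2}(U_card n.+1 isT) (leq_trans (GK N))// leq_mul2r.
    by rewrite leq_Fprime_length ?orbT.
  - exact: Gg.
  - exact: Fl.
have lk1 := l_le1 _ k1; rewrite ger0_norm ?subr_ge0//.
by move: ge1 => /= /(le_trans (ler_norm _)); lra.
Unshelve. all: by end_near. Qed.
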